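(* Let $p(z)=a_3z^3+a_2z^2+a_1z+a_0$ be a cubic polynomial with complex coefficients ($a_3\ne0$). Let $c$ be a critical point of $p$ (a root of $p'$) with smallest polynomial modulus $|p(c)|$ among the critical points of $p$ (possibly the only critical point). Then the orbit of $c$ under the Robust Newton Method (RNM) converges to a root of $p(z)$. In particular, $c$ is computed by solving the quadratic equation $p'(z)=0$, and using the RNM orbit of $c$ a root of $p(z)$ is approximated to any precision; hence all roots of $p(z)$ can be approximated.
   Context: For a complex polynomial $p$ of degree $n\ge 2$ and $z\in\mathbb{C}$ with $p(z)\ne 0$, define $k=k(z)=\min\{j\ge 1: p^{(j)}(z)\ne 0\}$, $A(z)=\max\{|p^{(j)}(z)|/j! : j=0,\dots,n\}$, $u_k=u_k(z)=\frac{1}{k!}p(z)\overline{p^{(k)}(z)}$, $\gamma=2\,\mathrm{Re}(u_k^{k-1})$, $\delta=-2\,\mathrm{Im}(u_k^{k-1})$, $c_k=\max\{|\gamma|,|\delta|\}$ (with $u_k^{0}=1$). Let $\theta$ be any angle satisfying: $\theta=0$ if $c_k=|\gamma|$ and $\gamma<0$; $\theta=\pi/k$ if $c_k=|\gamma|$ and $\gamma>0$; $\theta=\pi/(2k)$ if $c_k=|\delta|$ and $\delta<0$; $\theta=3\pi/(2k)$ if $c_k=|\delta|$ and $\delta>0$ (if two cases apply, either value may be chosen). The Robust Newton iterate at $z$ is $$\widehat N_p(z)=z+\frac{C_k}{3}\frac{u_k}{|u_k|}e^{i\theta},\qquad C_k=\frac{c_k|u_k|^{2-k}}{6A^2(z)}.$$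 The Robust Newton Method (RNM) is the iteration $z_{t+1}=\widehat N_p(z_t)$; the resulting sequence starting at $z_0$ is the RNM orbit of $z_0$. If an iterate (including $z_0$) is a root of $p$, the orbit is taken to stay at that root. *)

(* Defs.v *)
From HB Require Import structures.
From mathcomp Require Import all_boot all_order all_algebra.
From mathcomp Require Import all_classical all_reals all_analysis.
From mathcomp Require Import complex.

Set Implicit Arguments.
Unset Strict Implicit.
Unset Printing Implicit Defensive.

Import Order.TTheory GRing.Theory Num.Theory.
Import numFieldNormedType.Exports.
Import ComplexField.Normc.

Local Open Scope ring_scope.

Section RobustNewton.
Variable R : realType.
Local Notation C := (R[i]).
Implicit Types (p : {poly C}) (z : C) (t : R).

(* The modulus is [normc : R[i] -> R]: the norm [`|z|] of the numeric
   structure on R[i] is again an element of R[i]. *)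

Definition expi t : C := (cos t +i* sin t)%C.

(* [find] returns a position in 0, 1, ..., n = deg p, hence the least order
   j >= 1 with p^(j)(z) != 0 whenever deg p >= 1, since then p^(n) is a nonzero
   constant (see [rnm_kP]). *)
Definition rnm_k p z : nat :=
  find (fun j => (0 < j)%N && (p^`(j).[z] != 0)) (iota 0 (size p)).

(* j ranges over 0, ..., n because [size p = n + 1]; all terms are >= 0, so
   the default value 0 does not affect the maximum. *)
Definition rnm_A p z : R :=
  \big[Num.max/0]_(j < size p) (normc p^`(j).[z] / (j`!)%:R).

Definition rnm_u p z : C :=
  ((rnm_k p z)`!)%:R^-1 * p.[z] * ((p^`(rnm_k p z).[z])^*)%C.

Definition rnm_gamma p z : R :=
  2 * complex.Re (rnm_u p z ^+ (rnm_k p z).-1).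

Definition rnm_delta p z : R :=
  - (2 * complex.Im (rnm_u p z ^+ (rnm_k p z).-1)).

Definition rnm_c p z : R := Num.max `|rnm_gamma p z| `|rnm_delta p z|.

Definition rnm_angle p z t : Prop :=
  let k := (rnm_k p z)%:R in
  [\/ [/\ rnm_c p z = `|rnm_gamma p z|, rnm_gamma p z < 0 & t = 0],
      [/\ rnm_c p z = `|rnm_gamma p z|, 0 < rnm_gamma p z & t = pi / k],
      [/\ rnm_c p z = `|rnm_delta p z|, rnm_delta p z < 0
        & t = pi / (2 * k)]
    | [/\ rnm_c p z = `|rnm_delta p z|, 0 < rnm_delta p z
        & t = 3 * pi / (2 * k)]].

(* The exponent 2 - k is an integer and may be negative. *)
Definition rnm_C p z : R :=
  rnm_c p z * normc (rnm_u p z) ^ (2 - (rnm_k p z)%:Z) / (6 * rnm_A p z ^+ 2).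

Definition robust_newton p z t : C :=
  z + (rnm_C p z / 3)%:C%C * (rnm_u p z / (normc (rnm_u p z))%:C%C) * expi t.

(* When two angles are admissible the iterate is not unique, so an orbit is
   specified by a relation: any admissible angle may be used at each step. *)
Definition rnm_orbit p (z0 : C) (z : nat -> C) : Prop :=
  z 0%N = z0 /\
  forall n, if root p (z n) then z n.+1 = z n
            else exists t, rnm_angle p (z n) t /\
                           z n.+1 = robust_newton p (z n) t.

(* The two solutions of a X^2 + b X + c = 0; the boolean selects the sign. *)
Definition quad_root (s : bool) (a b c : C) : C :=
  (- b + (-1) ^+ s * sqrtC (b ^+ 2 - 4 * a * c)) / (2 * a).

Definition deflated_root (s : bool) p z : C :=
  let q := p %/ ('X - z%:P) in quad_root s q`_2 q`_1 q`_0.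

Lemma rnm_kP p z : (1 < size p)%N ->
  [/\ (0 < rnm_k p z)%N, p^`(rnm_k p z).[z] != 0
    & forall j, (0 < j < rnm_k p z)%N -> p^`(j).[z] = 0].
Proof.
move=> sp.
set a := fun j => (0 < j)%N && (p^`(j).[z] != 0).
have hp : has a (iota 0 (size p)).
  apply/hasP; exists (size p).-1.
    by rewrite mem_iota /= add0n ltn_predL (ltn_trans _ sp).
  rewrite /a -subn1 subn_gt0 sp subn1 /=.
  have s1 : (size p^`((size p).-1) <= 1)%N.
    apply/leq_sizeP => j j1; rewrite coef_derivn nth_default ?mul0rn //.
    by rewrite -(prednK (ltn_trans (ltn0Sn 0) sp)) /= -addn1 leq_add2l.
  rewrite (size1_polyC s1) hornerC coef_derivn addn0 ffactnn.
  rewrite mulrn_eq0 negb_or -lt0n fact_gt0 /= -/(lead_coef p) lead_coef_eq0.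
  by rewrite -size_poly_gt0 (ltn_trans _ sp).
have kl : (rnm_k p z < size p)%N.
  by move: hp; rewrite has_find size_iota.
have := nth_find 0%N hp; rewrite -/(rnm_k p z) nth_iota // add0n => /andP[k0 k1].
split=> // j /andP[j0 jk].
have := before_find 0%N jk; rewrite nth_iota ?(ltn_trans jk) // add0n j0 /=.
by move/negbFE/eqP.
Qed.

Lemma rnm_angle_ex p z : (1 < size p)%N -> ~~ root p z ->
  exists t, rnm_angle p z t.
Proof.
move=> sp pz; have [k0 pk _] := rnm_kP z sp.
have u0 : rnm_u p z != 0.
  rewrite /rnm_u !mulf_neq0 ?invr_eq0 ?pnatr_eq0 -?lt0n ?fact_gt0 //.
  by rewrite conjc_eq0.
have c0 : 0 < rnm_c p z.
  rewrite /rnm_c lt_max !normr_gt0 /rnm_gamma /rnm_delta.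
  rewrite oppr_eq0 !mulf_eq0 pnatr_eq0 /= -negb_and.
  apply: contra (expf_neq0 (rnm_k p z).-1 u0).
  by case: (rnm_u p z ^+ _) => x y /= /andP[/eqP-> /eqP->].
have [cE|cE] : rnm_c p z = `|rnm_gamma p z| \/ rnm_c p z = `|rnm_delta p z|.
- by rewrite /rnm_c; case: leP => _; [right|left].
- move: (c0); rewrite cE normr_gt0 => /lt_total /orP[h|h].
  + by exists 0; constructor 1.
  + by exists (pi / (rnm_k p z)%:R); constructor 2.
- move: (c0); rewrite cE normr_gt0 => /lt_total /orP[h|h].
  + by exists (pi / (2 * (rnm_k p z)%:R)); constructor 3.
  + by exists (3 * pi / (2 * (rnm_k p z)%:R)); constructor 4.
Qed.

Lemma rnm_orbit_ex p (z0 : C) : (1 < size p)%N ->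
  exists z : nat -> C, rnm_orbit p z0 z.
Proof.
move=> sp.
pose P (z z' : C) := if root p z then z' = z
  else exists t, rnm_angle p z t /\ z' = robust_newton p z t.
have [f fP] : {f : C -> C & forall z, P z (f z)}.
  apply: (@choice _ _ P) => z; rewrite /P; case: (boolP (root p z)) => pz; first by exists z.
  have [t ht] := rnm_angle_ex sp pz.
  by exists (robust_newton p z t), t.
by exists (fun n => iter n f z0); split=> // n; exact: fP.
Qed.

End RobustNewton.

(* Main.v *)
(* One Robust Newton step decreases |p|. Write b = p^(k)(z) / k!, r = |z' - z|
   and p(z) + b h^k = p(z) (1 + w) with h = z' - z: the angle makes
   Re w <= - |w| / 2, and r <= |u| / (9 A^2) makes both |w| and the Taylor
   remainder small, so that |p(z')| <= |p(z)| - |b| r^k / 4.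

   If |p| is at c no larger than at every critical point and p(c) <> 0, then
   after one step the orbit lies in a sublevel set {|p| <= m} with m smaller than
   every critical value. This set is bounded and |p'| is bounded below on it, so
   from then on k = 1, |p| decays geometrically, and the step lengths, being
   O(|p|), are summable: the orbit converges, and p vanishes at its limit.

   The other two roots are those of the deflated quadratic, whose coefficients
   depend continuously on z. *)
Require Import Defs.
From HB Require Import structures.
From mathcomp Require Import all_boot all_order all_algebra.
From mathcomp Require Import all_classical all_reals all_analysis.
From mathcomp Require Import complex ring lra.
Import Order.TTheory GRing.Theory Num.Theory.
Import numFieldNormedType.Exports.
Import ComplexField.Normc.
Local Open Scope classical_set_scope.
Local Open Scope ring_scope.

Set Implicit Arguments.
Unset Strict Implicit.
Unset Printing Implicit Defensive.

(** * The complex modulus with real values *)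

Section Modulus.
Variable R : realType.
Local Notation C := R[i].
Implicit Types (x y z : C).

Lemma normcE x : `|x| = (normc x)%:C%C. Proof. by []. Qed.

Lemma normc_ge0 x : 0 <= normc x.
Proof. by rewrite -ler0c -normcE. Qed.

Lemma normc_eq0 x : (normc x == 0) = (x == 0).
Proof. by apply/eqP/eqP => [/eq0_normc|->]; rewrite ?normc0. Qed.

Lemma normc_gt0 x : (0 < normc x) = (x != 0).
Proof. by rewrite lt_neqAle normc_ge0 andbT eq_sym normc_eq0. Qed.

Lemma ler_normcD x y : normc (x + y) <= normc x + normc y.
Proof. exact: le_normcD. Qed.

Lemma normc_opp x : normc (- x) = normc x.
Proof. exact: normcN. Qed.

Lemma normc_distC x y : normc (x - y) = normc (y - x).
Proof. by rewrite -normc_opp opprB. Qed.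

Lemma ler_normcB x y : normc x - normc y <= normc (x - y).
Proof. by rewrite lerBlDr; have := ler_normcD (x - y) y; rewrite subrK. Qed.

Lemma normcX x n : normc (x ^+ n) = normc x ^+ n.
Proof. by elim: n => [|n IH]; rewrite ?expr0 ?normc1 // !exprS normcM IH. Qed.

Lemma normc_real (r : R) : normc r%:C%C = `|r|.
Proof. by rewrite /normc /= expr0n addr0 sqrtr_sqr. Qed.

Lemma normc_conj x : normc x^*%C = normc x.
Proof. by case: x => a b; rewrite /normc /= sqrrN. Qed.

Lemma normc_nat n : normc (n%:R : C) = n%:R.
Proof. by rewrite -[n%:R](rmorph_nat (real_complex R)) normc_real ger0_norm. Qed.

Lemma normc_sum (I : Type) (r : seq I) (P : pred I) (F : I -> C) :
  normc (\sum_(i <- r | P i) F i) <= \sum_(i <- r | P i) normc (F i).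
Proof.
elim/big_rec2: _ => [|i a b _ ab]; first by rewrite normc0.
by rewrite (le_trans (ler_normcD _ _))// lerD2l.
Qed.

Lemma normc_Re_Im x : normc x ^+ 2 = complex.Re x ^+ 2 + complex.Im x ^+ 2.
Proof. by case: x => a b; rewrite /normc /= sqr_sqrtr// addr_ge0 ?sqr_ge0. Qed.

Lemma normc_ge_absRe x : `|complex.Re x| <= normc x.
Proof.
rewrite -(@ler_pXn2r _ 2)// ?nnegrE ?normc_ge0// normc_Re_Im real_normK ?num_real//.
by rewrite lerDl sqr_ge0.
Qed.

Lemma normc_ge_absIm x : `|complex.Im x| <= normc x.
Proof.
rewrite -(@ler_pXn2r _ 2)// ?nnegrE ?normc_ge0// normc_Re_Im real_normK ?num_real//.
by rewrite lerDr sqr_ge0.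
Qed.

Lemma normc_le_Re_Im x : normc x <= `|complex.Re x| + `|complex.Im x|.
Proof.
rewrite -(@ler_pXn2r _ 2)// ?nnegrE ?normc_ge0 ?addr_ge0//.
rewrite normc_Re_Im sqrrD !real_normK ?num_real// lerD2r lerDl.
by rewrite mulrn_wge0// mulr_ge0.
Qed.

Lemma mulc_conj x : x * x^*%C = (normc x ^+ 2)%:C%C.
Proof. by rewrite -sqr_normc normcE rmorphXn. Qed.

(* sqrt (1 + s) <= 1 + s / 2 *)
Lemma normc_1D_le x : normc (1 + x) <= 1 + complex.Re x + normc x ^+ 2 / 2.
Proof.
rewrite -(@ler_pXn2r _ 2)// ?nnegrE ?normc_ge0//; last first.
  rewrite normc_Re_Im; case: x => a b /=; nra.
rewrite !normc_Re_Im; case: x => a b /=; rewrite add0r.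
have -> : (1 + a) ^+ 2 + b ^+ 2 = 1 + 2 * (a + (a ^+ 2 + b ^+ 2) / 2) by field.
rewrite -addrA; set s := a + _; nra.
Qed.

Lemma normc_expi (t : R) : normc (expi t) = 1.
Proof. by rewrite /normc /= cos2Dsin2 sqrtr1. Qed.

Lemma expiX (t : R) n : expi t ^+ n = expi (n%:R * t).
Proof.
elim: n => [|n IH]; first by rewrite expr0 mul0r /expi cos0 sin0.
rewrite exprSr IH -natr1 mulrDl mul1r /expi cosD sinD; simpc.
by congr (_ +i* _)%C; rewrite addrC.
Qed.

(** The bound 9/8 is 1 / (1 - 1/9), the fixed point of s = 1 + s/9, so it survives the induction.
    The ratio will be a step length, which is at most 1/9. *)
Lemma geometric_sum_le (x : R) (n : nat) : 0 <= x <= 1 / 9 ->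
  \sum_(i < n) x ^+ i <= 9 / 8.
Proof.
move=> /andP[x0 x1]; elim: n => [|n IH]; first by rewrite big_ord0; lra.
rewrite big_ord_recl expr0; under eq_bigr do rewrite exprS.
rewrite -mulr_sumr; set s := \sum_(_ < _) _ in IH *.
have : x * s <= 1/9 * (9/8) by rewrite ler_pM// sumr_ge0// => i _; rewrite exprn_ge0.
lra.
Qed.

End Modulus.

(** * A single Robust Newton step *)

Section Step.
Variable R : realType.
Local Notation C := R[i].
Variables (p : {poly C}) (z : C).
Hypothesis sp : (1 < size p)%N.
Local Notation k := (rnm_k p z).
Local Notation A := (rnm_A p z).
Local Notation u := (rnm_u p z).
Local Notation b := (p^`N(k).[z]).

Lemma nderivn_hornerE (j : nat) : p^`(j).[z] = (j`!)%:R * p^`N(j).[z].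
Proof. by rewrite nderivn_def hornerMn mulr_natl. Qed.

Lemma rnm_A_ge (j : nat) : normc p^`N(j).[z] <= A.
Proof.
(* Beyond the degree the Taylor coefficient vanishes, and the default value 0 of the maximum already
   bounds it. *)
have [js|js] := ltnP j (size p); last first.
  by rewrite nderivn_poly0 // horner0 normc0 /rnm_A bigmax_ge_id.
rewrite /rnm_A; apply: le_trans (le_bigmax _ _ (Ordinal js)) => /=.
rewrite nderivn_hornerE normcM normc_nat mulrAC divff ?mul1r//.
Qed.

Lemma rnm_A_ge0 : 0 <= A.
Proof. exact: le_trans (normc_ge0 _) (rnm_A_ge 0). Qed.

Lemma rnm_k_gt0 : (0 < k)%N.
Proof. by have [] := rnm_kP z sp. Qed.

Lemma nderivn_rnm_k_neq0 : b != 0.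
Proof.
have [_ + _] := rnm_kP z sp; apply: contra => /eqP.
by rewrite nderivn_hornerE => ->; rewrite mulr0.
Qed.

Lemma nderivn_lt_rnm_k_eq0 (j : nat) : (0 < j < k)%N -> p^`N(j).[z] = 0.
Proof.
have [_ _ h] := rnm_kP z sp; move=> /h /eqP.
by rewrite nderivn_hornerE mulf_eq0 pnatr_eq0 -leqn0 leqNgt fact_gt0 => /eqP.
Qed.

Lemma rnm_k_lt : (k < size p)%N.
Proof.
rewrite ltnNge; apply/negP => /(@nderivn_poly0 _ p k) e.
by have := nderivn_rnm_k_neq0; rewrite e horner0 eqxx.
Qed.

Lemma rnm_A_gt0 : 0 < A.
Proof. by rewrite (lt_le_trans _ (rnm_A_ge k))// normc_gt0 nderivn_rnm_k_neq0. Qed.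

Lemma rnm_uE : u = p.[z] * b^*%C.
Proof.
rewrite /rnm_u nderivn_hornerE rmorphM /= conjc_nat mulrACA mulVf ?mul1r//.
Qed.

Lemma normc_u : normc u = normc p.[z] * normc b.
Proof. by rewrite rnm_uE normcM normc_conj. Qed.

(** With v = u^(k-1), [rnm_c] is twice the larger of |Re v| and |Im v|: at least their sum, hence at
    least |v|, and at most 2|v|. *)
Lemma rnm_c_bounds :
  normc u ^+ k.-1 <= rnm_c p z <= 2 * normc u ^+ k.-1.
Proof.
rewrite /rnm_c /rnm_gamma /rnm_delta normrN !normrM (ger0_norm (_ : 0 <= 2))//.
rewrite -normcX; set v := u ^+ _.
have := normc_ge_absRe v; have := normc_ge_absIm v; have := normc_le_Re_Im v.
rewrite ge_max le_max; lra.
Qed.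

(** The four angles turn e^(ikt) into 1, -1, i, -i. Multiplication by it brings the dominant one of
    the real and imaginary parts of u^(k-1) onto the negative real axis. *)
Lemma Re_rnm_angle (t : R) : rnm_angle p z t ->
  complex.Re (u ^+ k.-1 * expi t ^+ k) = - (rnm_c p z / 2).
Proof.
have k0 : k%:R != 0 :> R by rewrite pnatr_eq0 -lt0n rnm_k_gt0.
have hk (s : R) : k%:R * (s / (2 * k%:R)) = s / 2.
  by move: k0; set K : R := _%:R => K0; field.
rewrite expiX; case=> -[-> + ->].
- move=> h; rewrite mulr0 ltr0_norm// /expi cos0 sin0 /rnm_gamma.
  by case: (u ^+ _) => x y /=; field.
- move=> h; rewrite gtr0_norm// mulrCA divff// mulr1 /expi cospi sinpi /rnm_gamma.
  by case: (u ^+ _) => x y /=; field.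
- move=> h; rewrite ltr0_norm// hk /expi cos_pihalf sin_pihalf /rnm_delta.
  by case: (u ^+ _) => x y /=; field.
- move=> h; rewrite gtr0_norm// hk.
  have -> : 3 * pi / 2 = pi / 2 + pi :> R by field.
  rewrite /expi cosDpi sinDpi cos_pihalf sin_pihalf /rnm_delta.
  by case: (u ^+ _) => x y /=; field.
Qed.

Local Notation r := (rnm_C p z / 3).

Hypothesis pz : p.[z] != 0.

Lemma normc_u_gt0 : 0 < normc u.
Proof. by rewrite normc_u mulr_gt0 ?normc_gt0 ?nderivn_rnm_k_neq0. Qed.

(** The factor |u|^(2-k) reduces the size |u|^(k-1) of [rnm_c] to |u|, so the step is comparable to
    |u| / A^2 whatever k is. Here 18 = 3 * 6, and the upper bound in [rnm_c_bounds] loses a factor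
    2. *)
Lemma rnm_step_bounds :
  normc u / (18 * A ^+ 2) <= r <= normc u / (9 * A ^+ 2).
Proof.
have A0 := rnm_A_gt0; have u0 := normc_u_gt0.
have vE : normc u ^+ k.-1 * normc u ^ (2 - k%:Z) = normc u.
  rewrite exprnP -expfzDr ?gt_eqF// -[RHS]expr1z; congr (_ ^ _).
  by have := rnm_k_gt0; case: (rnm_k _ _) => //= n _; rewrite intS; ring.
have w0 : 0 < normc u ^ (2 - k%:Z) by rewrite exprz_gt0.
have rE : r = rnm_c p z * normc u ^ (2 - k%:Z) / (18 * A ^+ 2).
  rewrite /rnm_C; move: (rnm_A p z) A0 (rnm_c p z) (_ ^ _) => a a0 x y.
  by field; rewrite gt_eqF.
have D0 : 0 < (18 * A ^+ 2)^-1 by rewrite invr_gt0 mulr_gt0 ?exprn_gt0.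
rewrite rE; have -> : normc u / (9 * A ^+ 2) = 2 * normc u / (18 * A ^+ 2).
  by field; rewrite gt_eqF.
rewrite !ler_pM2r// -{1 4}vE mulrA !ler_pM2r//; exact: rnm_c_bounds.
Qed.

Lemma rnm_step_gt0 : 0 < r.
Proof.
have /andP[+ _] := rnm_step_bounds; apply: lt_le_trans.
by rewrite divr_gt0 ?normc_u_gt0// mulr_gt0 ?exprn_gt0 ?rnm_A_gt0.
Qed.

Lemma normc_rnm_step (t : R) : normc (robust_newton p z t - z) = r.
Proof.
rewrite /robust_newton addrC addKr; have u0 := normc_u_gt0.
have := ltW rnm_step_gt0; move: (rnm_C p z / 3) (rnm_u p z) u0 => s v v0 s0.
rewrite !normcM normc_expi mulr1 normcV !normc_real.
by rewrite (ger0_norm s0) (ger0_norm (normc_ge0 v)) divff ?mulr1// gt_eqF.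
Qed.

(** Orders strictly between 0 and k vanish by the choice of k. In the orders above k, all
    coefficients are at most A, and factoring out |h|^(k+1) leaves a geometric sum. *)
Lemma taylor_remainder (h : C) : normc h <= 1 / 9 ->
  normc (p.[z + h] - (p.[z] + b * h ^+ k)) <= A * normc h ^+ k.+1 * (9 / 8).
Proof.
move=> h9; rewrite (nderiv_taylor p (mulrC _ _)).
rewrite -(big_mkord xpredT (fun i => p^`N(i).[z] * h ^+ i)).
rewrite (big_cat_nat (n := k.+1))//=; last exact: rnm_k_lt.
rewrite big_nat_recr//= big_ltn ?rnm_k_gt0//= [X in _ + X + _ + _ - _]big1_seq; last first.
  by move=> i; rewrite mem_index_iota => /andP[_ /nderivn_lt_rnm_k_eq0 ->]; rewrite mul0r.
rewrite nderivn0 expr0 mulr1 addr0 [X in normc (X - _)]addrC addrK.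
apply: le_trans (normc_sum _ _ _) _.
rewrite -{1}[k.+1]add0n big_addn big_mkord.
rewrite -(mulrA A).
apply: (@le_trans _ _ (A * (normc h ^+ k.+1 * \sum_(i < size p - k.+1) normc h ^+ i))).
  rewrite mulr_sumr mulr_sumr ler_sum// => i _; rewrite normcM normcX addnC exprD.
  by rewrite ler_wpM2r ?mulr_ge0 ?exprn_ge0 ?normc_ge0 ?rnm_A_ge.
rewrite ler_wpM2l ?rnm_A_ge0// ler_wpM2l ?exprn_ge0 ?normc_ge0//.
by rewrite geometric_sum_le// normc_ge0.
Qed.

(** Both factors of |u| = |p(z)| |b| are Taylor coefficients, so |u| <= A^2. *)
Lemma rnm_step_le : r <= 1 / 9.
Proof.
have /andP[_ /le_trans] := rnm_step_bounds; apply.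
have A0 := rnm_A_gt0; rewrite invfM mulrCA mul1r ler_piMr ?invr_ge0//.
rewrite ler_pdivrMr ?exprn_gt0// mul1r normc_u expr2.
by have := rnm_A_ge 0; rewrite nderivn0 => pA; rewrite ler_pM ?normc_ge0 ?rnm_A_ge.
Qed.

Lemma robust_newton_descent (t : R) : rnm_angle p z t ->
  normc p.[robust_newton p z t] <= normc p.[z] - normc b * r ^+ k / 4.
Proof.
(* The angle contributes -|w|/2 and the quadratic term at most |w|/18, which leaves -4|w|/9. The
   remainder costs rho/8, and 4/9 - 1/8 > 1/4. *)
have bound1 (x y : R) : x <= y / 9 -> x * (9 / 8) <= y / 8 by lra.
have bound2 (x y s v : R) : x <= 1 + y + v / 2 -> v <= s / 9 -> y <= - (s / 2) ->
  x <= 1 - s * (4 / 9) by lra.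
have bound3 (x y s v m q : R) : x - y <= s -> s <= v -> v <= m / 8 ->
  y <= q - m * (4 / 9) -> 0 < m -> x <= q - m / 4 by lra.
move=> ht; set z' := robust_newton p z t; pose h := z' - z.
have hr : normc h = r by exact: normc_rnm_step.
have r0 := rnm_step_gt0; have r9 := rnm_step_le.
have A0 := rnm_A_gt0; have u0 := normc_u_gt0.
have p0 : 0 < normc p.[z] by rewrite normc_gt0.
have b0 : 0 < normc b by rewrite normc_gt0 nderivn_rnm_k_neq0.
have z'E : z' = z + h by rewrite /h addrC subrK.
pose w := b * h ^+ k / p.[z].
pose rho := normc b * r ^+ k.
have rho0 : 0 < rho by rewrite mulr_gt0 ?exprn_gt0.
have rhow : rho = normc p.[z] * normc w.
  by rewrite /w normcM normcV normcM normcX hr mulrCA divff ?mulr1// gt_eqF.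
(* Since b u = p(z) |b|^2, the quotient w is a nonnegative real multiple s of u^(k-1) e^(ikt), whose
   real part is known from [Re_rnm_angle]. *)
pose s := normc b ^+ 2 * (r ^+ k / normc u ^+ k).
have wE : w = s%:C%C * (u ^+ k.-1 * expi t ^+ k).
  have hE : h = r%:C%C * (u / (normc u)%:C%C) * expi t.
    by rewrite /h /z' /robust_newton addrC addKr.
  have bu : b * u = p.[z] * (normc b ^+ 2)%:C%C by rewrite rnm_uE mulrCA mulc_conj.
  have uk : u ^+ k = u * u ^+ k.-1 by rewrite -exprS prednK ?rnm_k_gt0.
  rewrite /w hE /s; move: (rnm_C p z / 3) (normc u) => y N.
  move: (rnm_u p z) bu uk => v bu uk.
  rewrite !exprMn uk exprVn !(rmorphM (real_complex R)) /=.
  rewrite (fmorphV (real_complex R)) !(rmorphXn (real_complex R)) /=.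
  rewrite (rmorphXn (real_complex R)) /= in bu.
  move: (v ^+ k.-1) (expi t ^+ k) (y%:C%C ^+ k) ((_ ^+ k)^-1) => x1 x2 x3 x4.
  apply: (canLR (mulfK pz)).
  have -> : b * (x3 * (v * x1 * x4) * x2) = b * v * (x3 * x1 * x4 * x2) by ring.
  by rewrite bu; ring.
have s0 : 0 <= s by rewrite mulr_ge0 ?divr_ge0 ?exprn_ge0 ?normc_ge0// ltW.
have Rew : complex.Re w <= - (normc w / 2).
  have ReZ (x : C) : complex.Re (s%:C%C * x) = s * complex.Re x.
    by case: x => x y; simpc.
  rewrite wE ReZ Re_rnm_angle// !normcM !normcX normc_expi expr1n mulr1 normc_real.
  rewrite ger0_norm// mulrN lerN2 -mulrA ler_wpM2l// ler_pM2r ?invr_gt0//.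
  by case/andP: rnm_c_bounds.
(* One factor A is cancelled against |p(z)| or |b|, both at most A. The resulting bound A r <= |b|/9
   controls the Taylor remainder, and A r <= |p(z)|/9 controls |w|. *)
have A2r : A * (A * r) <= normc p.[z] * normc b / 9.
  have /andP[_] := rnm_step_bounds; rewrite normc_u ler_pdivlMr ?mulr_gt0 ?exprn_gt0//.
  have <- : A * (A * r) * 9 = r * (9 * A ^+ 2) by ring.
  by rewrite ler_pdivlMr.
have pA : normc p.[z] <= A by have := rnm_A_ge 0; rewrite nderivn0.
have bA : normc b <= A by exact: rnm_A_ge.
have Arb : A * r <= normc b / 9.
  rewrite -(ler_pM2l A0) (le_trans A2r)// -mulrA ler_wpM2r//.
  by rewrite divr_ge0// normc_ge0.
have Arp : A * r <= normc p.[z] / 9.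
  rewrite -(ler_pM2l A0) (le_trans A2r)// mulrAC [leRHS]mulrC.
  by rewrite ler_wpM2l// divr_ge0// normc_ge0.
have w9 : normc w <= 1 / 9.
  rewrite -(ler_pM2l p0) -rhow mul1r (le_trans _ Arp)// /rho.
  have -> : r ^+ k = r * r ^+ k.-1 by rewrite -exprS prednK ?rnm_k_gt0.
  rewrite (mulrA (normc b)).
  apply: (@le_trans _ _ (normc b * r)); last by rewrite ler_wpM2r// ltW.
  rewrite ler_piMr ?(ltW (mulr_gt0 b0 r0))//.
  by apply: exprn_ile1; lra.
have Arem : A * r ^+ k.+1 * (9 / 8) <= rho / 8.
  have : A * r * r ^+ k <= normc b / 9 * r ^+ k.
    by rewrite ler_wpM2r// exprn_ge0// ltW.
  by rewrite (mulrAC (normc b)) -(mulrA A) -exprS => /bound1.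
have main : normc (p.[z] + b * h ^+ k) <= normc p.[z] - rho * (4 / 9).
  have -> : p.[z] + b * h ^+ k = p.[z] * (1 + w).
    by rewrite mulrDr mulr1 /w mulrCA divff ?mulr1.
  have w2 : normc w ^+ 2 <= normc w / 9.
    by rewrite expr2 ler_wpM2l ?normc_ge0// -[9^-1]mul1r.
  have ww : normc (1 + w) <= 1 - normc w * (4 / 9).
    exact: bound2 (normc_1D_le w) w2 Rew.
  rewrite normcM rhow -mulrA -[X in _ <= X - _]mulr1 -mulrBr.
  by rewrite ler_wpM2l// normc_ge0.
have rem : normc (p.[z'] - (p.[z] + b * h ^+ k)) <= A * r ^+ k.+1 * (9 / 8).
  by rewrite z'E -hr; apply: taylor_remainder; rewrite hr.
exact: bound3 (ler_normcB _ _) rem Arem main rho0.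
Qed.

End Step.

(** * Continuity of polynomials and estimates on sublevel sets *)

Section PolynomialEstimates.
Variable R : realType.
Local Notation C := R[i].
Implicit Types (p q : {poly C}) (z w : C).

Lemma normc_horner_le q (B : R) z : normc z <= B ->
  normc q.[z] <= \sum_(i < size q) normc q`_i * B ^+ i.
Proof.
move=> zB; rewrite horner_coef (le_trans (normc_sum _ _ _))// ler_sum// => i _.
rewrite normcM normcX ler_wpM2l ?normc_ge0// lerXn2r// nnegrE ?normc_ge0//.
exact: le_trans (normc_ge0 _) zB.
Qed.

(** The difference q - q(w) is divisible by X - w, and the quotient is bounded by M on the unit disc
    around w. *)
Lemma horner_cvg q w (e : R) : 0 < e ->
  exists2 d : R, 0 < d & forall z, normc (z - w) < d -> normc (q.[z] - q.[w]) < e.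
Proof.
move=> e0.
have /factor_theorem[s sE] : root (q - q.[w]%:P) w.
  by rewrite /root !hornerE subrr.
pose M := \sum_(i < size s) normc s`_i * (normc w + 1) ^+ i.
have M0 : 0 <= M.
  by apply: sumr_ge0 => i _; rewrite mulr_ge0 ?exprn_ge0 ?addr_ge0 ?normc_ge0.
exists (Num.min 1 (e / (M + 1))); first by rewrite lt_min ltr01 divr_gt0// ltr_wpDl.
move=> z; rewrite lt_min => /andP[z1]; rewrite ltr_pdivlMr ?ltr_wpDl// => ze.
have -> : q.[z] - q.[w] = s.[z] * (z - w).
  by have /(congr1 (horner^~ z)) := sE; rewrite !hornerE.
rewrite normcM; apply: le_lt_trans ze; rewrite mulrC ler_wpM2l ?normc_ge0//.
rewrite (le_trans (@normc_horner_le s (normc w + 1) z _)) ?lerDl//.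
by have := ler_normcB z w; lra.
Qed.

Lemma normc_horner_prod (rs : seq C) z (a : C) :
  normc (a *: \prod_(x <- rs) ('X - x%:P)).[z] = normc a * \prod_(x <- rs) normc (z - x).
Proof.
rewrite hornerZ normcM horner_prod; congr (_ * _).
elim/big_rec2: _ => [|x y v _ <-]; first by rewrite normc1.
by rewrite normcM !hornerE.
Qed.

(** If |z| exceeds the sum of the moduli of the roots by K >= 1, each factor |z - x| is at least K.
    There is at least one factor, so |p(z)| >= |a| K, and K is chosen to make this exceed m. *)
Lemma sublevel_bounded p (m : R) : (1 < size p)%N ->
  exists B : R, forall z, normc p.[z] <= m -> normc z <= B.
Proof.
move=> sp; have [rs pE] := closed_field_poly_normal p.
have a0 : 0 < normc (lead_coef p).
  by rewrite normc_gt0 lead_coef_eq0 -size_poly_gt0 (ltn_trans _ sp).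
set a := lead_coef p in pE a0; pose K := 1 + `|m| / normc a.
have K1 : 1 <= K by rewrite lerDl divr_ge0// normc_ge0.
exists (K + \sum_(x <- rs) normc x) => z; apply: contraTT; rewrite -!ltNge => zB.
have far x : x \in rs -> K <= normc (z - x).
  move=> xrs; apply: le_trans (ler_normcB _ _); rewrite lerBrDr (le_trans _ (ltW zB))//.
  rewrite lerD2l (big_rem x)//= lerDl sumr_ge0// => i _; exact: normc_ge0.
have rs0 : rs != [::].
  by apply/eqP => e; move: sp; rewrite pE e big_nil size_scale ?size_poly1// -normc_gt0.
have prodK : K <= \prod_(x <- rs) normc (z - x).
  clear pE zB; case: rs rs0 far => // x s _ far; rewrite big_cons -[K]mulr1.
  rewrite ler_pM// ?(le_trans ler01 K1) ?far ?mem_head//.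
  rewrite big_seq; elim/big_rec: _ => // y v ys v1.
  by rewrite -[1]mulr1 ler_pM// (le_trans K1)// far// inE ys orbT.
rewrite pE normc_horner_prod.
apply: lt_le_trans (_ : normc a * K <= _); last by rewrite ler_pM2l.
rewrite mulrDr mulr1 mulrCA divff ?gt_eqF// mulr1.
by rewrite (le_lt_trans (ler_norm m))// ltrDr.
Qed.

(** By continuity |p| stays above m on a disc around each root of q, so the sublevel set keeps a
    positive distance from every root. The product of these distances bounds |q| from below. It is
    applied with q = p'. *)
Lemma sublevel_deriv_ge p q (m : R) : q != 0 ->
  (forall w, root q w -> m < normc p.[w]) ->
  exists2 D : R, 0 < D & forall z, normc p.[z] <= m -> D <= normc q.[z].
Proof.
move=> q0 hq; have [rs qE] := closed_field_poly_normal q.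
have a0 : 0 < normc (lead_coef q) by rewrite normc_gt0 lead_coef_eq0.
set a := lead_coef q in qE a0.
suff [D D0 hD] : exists2 D : R, 0 < D &
    forall z, normc p.[z] <= m -> D <= \prod_(x <- rs) normc (z - x).
  exists (normc a * D) => [|z /hD zD]; first by rewrite mulr_gt0.
  by rewrite qE normc_horner_prod ler_wpM2l// normc_ge0.
have : {in rs, forall x, m < normc p.[x]}.
  move=> x xrs; apply: hq; rewrite qE rootZ -?normc_gt0// root_prod_XsubC//.
elim: rs {qE} => [_|x s IH hs]; first by exists 1 => // z _; rewrite big_nil.
have [|D D0 hD] := IH; first by move=> y ys; apply: hs; rewrite inE ys orbT.
have := hs x (mem_head _ _); rewrite -subr_gt0 => /(horner_cvg p x)[d d0 hd].
exists (d * D) => [|z zm]; first by rewrite mulr_gt0.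
rewrite big_cons ler_pM ?(ltW d0) ?(ltW D0) ?hD// leNgt; apply/negP => /hd.
by have := ler_normcB p.[x] p.[z]; rewrite normc_distC; lra.
Qed.

Lemma rnm_A_bounded p (B : R) :
  exists M : R, forall z, normc z <= B -> rnm_A p z <= M.
Proof.
exists (\sum_(j < size p) \sum_(i < size p^`N(j)) normc p^`N(j)`_i * B ^+ i) => z zB.
have B0 : 0 <= B by exact: le_trans (normc_ge0 z) zB.
have S0 (j : 'I_(size p)) : 0 <= \sum_(i < size p^`N(j)) normc p^`N(j)`_i * B ^+ i.
  by rewrite sumr_ge0// => i _; rewrite mulr_ge0 ?exprn_ge0 ?normc_ge0.
apply/bigmax_leP; split => [|j _]; first by rewrite sumr_ge0.
rewrite nderivn_hornerE normcM normc_nat mulrAC divff//.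
rewrite mul1r (bigD1 j)//= (le_trans (normc_horner_le _ zB))// lerDl.
by rewrite sumr_ge0// => i _; exact: S0.
Qed.

End PolynomialEstimates.

(** * Sequences with geometrically decaying increments *)

Section Convergence.
Variable R : realType.
Local Notation C := R[i].

(** The sequence is its first term plus a telescoping series dominated by a geometric one. *)
Lemma geometric_increments_cvg (x : nat -> R) (K q : R) : 0 <= q < 1 ->
  (forall n, `|x n.+1 - x n| <= K * q ^+ n) -> exists l : R, x @ \oo --> l.
Proof.
move=> /andP[q0 q1] hx.
have K0 : 0 <= K by have := hx 0%N; rewrite expr0 mulr1; apply: le_trans.
have cv : cvgn (series (fun n => x n.+1 - x n)).
  apply: normed_cvg; apply: (@series_le_cvg _ _ (geometric K q)).
  - by move=> n /=.
  - by move=> n; rewrite /= mulr_ge0 ?exprn_ge0.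
  - by move=> n; exact: hx.
  - by apply: is_cvg_geometric_series; rewrite ger0_norm.
exists (x 0%N + limn (series (fun n => x n.+1 - x n))).
have xE : x = (fun=> x 0%N) \+ series (fun n => x n.+1 - x n).
  by apply/funext => n; rewrite /series /= telescope_sumr// addrC subrK.
by rewrite [X in X @ _ --> _]xE; apply: cvgD cv; exact: cvg_cst.
Qed.

Lemma normc_geometric_increments_cvg (z : nat -> C) (K q : R) : 0 <= q < 1 ->
  (forall n, normc (z n.+1 - z n) <= K * q ^+ n) ->
  exists zeta : C, forall e : R, 0 < e ->
    exists T : nat, forall t, (T <= t)%N -> normc (z t - zeta) < e.
Proof.
move=> q01 hz.
have [a ha] : exists l : R, (fun n => complex.Re (z n)) @ \oo --> l.
  apply: (geometric_increments_cvg q01) => n; apply: le_trans (hz n).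
  by rewrite -[_ - _](raddfB (@complex.Re R)); exact: normc_ge_absRe.
have [b hb] : exists l : R, (fun n => complex.Im (z n)) @ \oo --> l.
  apply: (geometric_increments_cvg q01) => n; apply: le_trans (hz n).
  by rewrite -[_ - _](raddfB (@complex.Im R)); exact: normc_ge_absIm.
exists (a +i* b)%C => e e0; have e2 : 0 < e / 2 by rewrite divr_gt0.
move/cvgrPdist_lt : ha => /(_ _ e2)[N1 _ h1].
move/cvgrPdist_lt : hb => /(_ _ e2)[N2 _ h2].
exists (maxn N1 N2) => t; rewrite geq_max => /andP[/h1 /= t1 /h2 /= t2].
rewrite normc_distC (le_lt_trans (normc_le_Re_Im _))//.
by case: (z t) t1 t2 => x y /=; lra.
Qed.

End Convergence.

(** * Convergence of orbits *)

Section Orbit.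
Variable R : realType.
Local Notation C := R[i].
Implicit Types (p : {poly C}) (z : C).

Lemma rnm_k_regular p z : (1 < size p)%N -> ~~ root p^`() z -> rnm_k p z = 1%N.
Proof.
move=> sp pz; apply/eqP; rewrite eqn_leq rnm_k_gt0// andbT leqNgt.
by apply: contra pz => k1; rewrite /root -nderivn1 (nderivn_lt_rnm_k_eq0 sp).
Qed.

(** On the sublevel set |p'| >= D > 0, hence k = 1 and b = p'(z). Descent then removes at least
    |b|^2 / (72 A^2) of |p(z)|, and A is bounded there. The step is at most |p(z)| |b| / (9 A^2),
    which |b| D <= A^2 turns into a multiple of |p(z)|. *)
Lemma robust_newton_contraction p (m : R) : (1 < size p)%N ->
  (forall w, root p^`() w -> m < normc p.[w]) -> p^`() != 0 ->
  exists K q : R, 0 <= q < 1 /\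
    forall z z', normc p.[z] <= m ->
      (if root p z then z' = z
       else exists t, rnm_angle p z t /\ z' = robust_newton p z t) ->
      normc p.[z'] <= q * normc p.[z] /\ normc (z' - z) <= K * normc p.[z].
Proof.
move=> sp hm p'0.
have [D D0 hD] := sublevel_deriv_ge p'0 hm.
have [B hB] := sublevel_bounded m sp.
have [M hM] := rnm_A_bounded p B.
(* Adding D makes M' positive and at least D, so that g <= 1. The 72 in g is 18 from the lower bound
   on the step times 4 from the descent. *)
pose M' := `|M| + D.
have M0 : 0 < M' by rewrite ltr_wpDl.
pose g := D ^+ 2 / (72 * M' ^+ 2).
have g0 : 0 < g by rewrite divr_gt0 ?mulr_gt0 ?exprn_gt0.
have g1 : g <= 1.
  rewrite ler_pdivrMr ?mulr_gt0 ?exprn_gt0// mul1r.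
  have : D ^+ 2 <= M' ^+ 2 
    by rewrite lerXn2r ?nnegrE ?(ltW D0) ?(ltW M0)// lerDr.
  have := exprn_gt0 2 M0; lra.
exists (1 / D), (1 - g); split; first by apply/andP; split; lra.
move=> z z' zm; case: ifPn => [/rootP pz -> | pz [t [ht ->]]].
  by rewrite pz subrr !normc0 !mulr0.
have p'z : D <= normc p^`().[z] := hD _ zm.
have k1 : rnm_k p z = 1%N.
  by rewrite rnm_k_regular// /root -normc_gt0 (lt_le_trans D0).
have A0 := rnm_A_gt0 z sp.
have AM : rnm_A p z <= M'.
  by rewrite (le_trans (hM _ (hB _ zm)))// (le_trans (ler_norm M))// lerDl ltW.
have p'A : normc p^`().[z] <= rnm_A p z by rewrite -nderivn1 rnm_A_ge.
have P0 : 0 < normc p.[z] by rewrite normc_gt0.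
have := robust_newton_descent sp pz ht; have := rnm_step_bounds sp pz.
rewrite (normc_rnm_step sp pz) normc_u// k1 nderivn1 expr1.
move: (rnm_C p z / 3) (normc p.[z]) (normc p^`().[z]) (rnm_A p z)
  (normc p.[robust_newton _ _ _]) p'z A0 AM p'A P0 => r P b A P' Db A0 AM bA P0 /andP[r1 r2] hP'.
have b0 : 0 < b by exact: lt_le_trans Db.
split.
- apply: le_trans hP' _; rewrite mulrBl mul1r lerD2l lerN2.
  have gA : g <= b ^+ 2 / (72 * A ^+ 2).
    rewrite ler_pM ?invr_ge0 ?exprn_ge0 ?mulr_ge0 ?exprn_ge0 ?(ltW D0) ?(ltW M0)//.
      by rewrite lerXn2r ?nnegrE ?(ltW D0) ?(ltW b0).
    rewrite lef_pV2 ?posrE ?mulr_gt0 ?exprn_gt0// ler_wpM2l//.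
    by rewrite lerXn2r ?nnegrE ?(ltW A0) ?(ltW M0).
  apply: (@le_trans _ _ (b ^+ 2 / (72 * A ^+ 2) * P)); first by rewrite ler_wpM2r ?(ltW P0).
  have -> : b ^+ 2 / (72 * A ^+ 2) * P = b * (P * b / (18 * A ^+ 2)) / 4.
    by field; rewrite gt_eqF.
  by rewrite ler_wpM2r// ler_wpM2l ?(ltW b0).
- apply: le_trans r2 _; rewrite ler_pdivrMr ?mulr_gt0 ?exprn_gt0//.
  have -> : 1 / D * P * (9 * A ^+ 2) = P * (9 * A ^+ 2 / D) by field; rewrite gt_eqF.
  rewrite ler_wpM2l ?(ltW P0)// ler_pdivlMr//.
  have : b * D <= A * A by rewrite ler_pM ?(ltW b0) ?(ltW D0)// (le_trans Db).
  by have := exprn_gt0 2 A0; rewrite expr2; lra.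
Qed.

(** The first step is treated apart, since k may exceed 1 at c. Its strict decrease gives the level
    m = |p(z_1)|, at which the contraction applies to all later steps. *)
Lemma rnm_orbit_cvg p (c : C) (z : nat -> C) : (1 < size p)%N ->
  (forall w, root p^`() w -> normc p.[c] <= normc p.[w]) -> rnm_orbit p c z ->
  exists2 zeta, root p zeta & forall e : R, 0 < e ->
    exists T : nat, forall t, (T <= t)%N -> normc (z t - zeta) < e.
Proof.
move=> sp hc [z0 hz]; have [pc|pc] := boolP (root p c).
  exists c => // e e0; exists 0%N => t _; suff -> : z t = c by rewrite subrr normc0.
  by elim: t => // t IH; have := hz t; rewrite IH pc.
have z1c : normc p.[z 1%N] < normc p.[c].
  have := hz 0%N; rewrite z0 (negPf pc) => -[t [ht ->]].
  apply: le_lt_trans (robust_newton_descent sp pc ht) _.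
  rewrite ltrBlDr ltrDl divr_gt0// mulr_gt0 ?exprn_gt0 ?rnm_step_gt0//.
  by rewrite normc_gt0 nderivn_rnm_k_neq0.
have hm w : root p^`() w -> normc p.[z 1%N] < normc p.[w].
  by move=> /hc; apply: lt_le_trans.
(* If p' were 0, then z_1 would be a root of p' and [hm] would give |p(z_1)| < |p(z_1)|. *)
have p'0 : p^`() != 0.
  by apply/eqP => e; have := hm (z 1%N); rewrite e root0 ltxx => /(_ isT).
have [K [q [/andP[q0 q1] step]]] := robust_newton_contraction sp hm p'0.
have decay n : normc p.[z n.+1] <= normc p.[z 1%N] * q ^+ n.
  elim: n => [|n IH]; first by rewrite expr0 mulr1.
  have le1 : normc p.[z n.+1] <= normc p.[z 1%N].
    by rewrite (le_trans IH)// ler_piMr ?normc_ge0// exprn_ile1 ?(ltW q1).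
  have [h _] := step _ _ le1 (hz n.+1).
  by rewrite (le_trans h)// exprS mulrCA ler_wpM2l.
have le1 n : normc p.[z n.+1] <= normc p.[z 1%N].
  by rewrite (le_trans (decay n))// ler_piMr ?normc_ge0// exprn_ile1 ?(ltW q1).
have [zeta hzeta] : exists zeta : C, forall e : R, 0 < e ->
    exists T : nat, forall t, (T <= t)%N -> normc (z t.+1 - zeta) < e.
  (* The sequence is shifted because the contraction starts at z_1; [|K|] is used because the
     contraction lemma does not record the sign of K. *)
  apply: (@normc_geometric_increments_cvg _ (fun n => z n.+1)
     (`|K| * normc p.[z 1%N]) q); first by rewrite q0.
  move=> n; have [_ h] := step _ _ (le1 n) (hz n.+1).
  rewrite (le_trans h)// -mulrA (@le_trans _ _ (`|K| * normc p.[z n.+1]))//.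
    by rewrite ler_wpM2r ?normc_ge0// ler_norm.
  by rewrite ler_wpM2l.
exists zeta; last first.
  move=> e /hzeta[T hT]; exists T.+1 => -[|t] //; rewrite ltnS; exact: hT.
(* At a late index n, |p(z_(n+1))| < e/2 by decay and |p(zeta) - p(z_(n+1))| < e/2 by continuity. *)
rewrite /root -normc_eq0 eq_le normc_ge0 andbT.
apply/ler_addgt0Pl => e e0; rewrite addr0.
have e2 : 0 < e / 2 by rewrite divr_gt0.
have [d d0 hd] := horner_cvg p zeta e2; have [T hT] := hzeta _ d0.
have qn1 : `|q| < 1 by rewrite ger0_norm.
have /cvgrPdist_lt := cvg_geometric (normc p.[z 1%N]) qn1; move=> /(_ _ e2)[N _ hN].
have n1 : (T <= maxn T N)%N by rewrite leq_maxl.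
have := hd _ (hT _ n1); have := hN (maxn T N) (leq_maxr _ _); rewrite /= sub0r normrN.
have := ler_norm (normc p.[z 1%N] * q ^+ maxn T N); have := decay (maxn T N).
by have := ler_normcB p.[zeta] p.[z (maxn T N).+1]; rewrite normc_distC; lra.
Qed.

End Orbit.

(** * Roots of quadratics and their dependence on the coefficients *)

Section Quadratic.
Variable R : realType.
Local Notation C := R[i].
Implicit Types (a b c w z : C).

Lemma quad_root_sum a b c : a != 0 ->
  b = - (a * (quad_root false a b c + quad_root true a b c)).
Proof.
by move=> a0; rewrite /quad_root; field.
Qed.

Lemma quad_root_prod a b c : a != 0 ->
  c = a * (quad_root false a b c * quad_root true a b c).
Proof.
move=> a0; rewrite /quad_root expr0 expr1.
have := sqrtCK (b ^+ 2 - 4 * a * c); move: (sqrtC _) => s sE.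
have -> : a * ((- b + 1 * s) / (2 * a) * ((- b + -1 * s) / (2 * a))) =
  (b ^+ 2 - s ^+ 2) / (4 * a) by field.
by rewrite sE; field.
Qed.

(** This follows from Vieta's formulas. A factorization, unlike a list of roots, also records a
    double root. *)
Lemma quad_factor a b c : a != 0 ->
  a *: 'X^2 + b *: 'X + c%:P =
  a *: (('X - (quad_root false a b c)%:P) * ('X - (quad_root true a b c)%:P)).
Proof.
move=> a0; have := quad_root_sum b c a0; have := quad_root_prod b c a0.
move: (quad_root _ _ _ _) (quad_root _ _ _ _) => v w -> ->.
by rewrite -!mul_polyC polyCN !polyCM polyCD; ring.
Qed.

Lemma root_quad a b c w : a != 0 ->
  root (a *: 'X^2 + b *: 'X + c%:P) w <-> exists s : bool, w = quad_root s a b c.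
Proof.
move=> a0; rewrite quad_factor// rootZ// rootM !root_XsubC; split.
  by case/orP => /eqP ->; [exists false | exists true].
by move=> [[] ->]; rewrite eqxx ?orbT.
Qed.

(** The smaller of |x - y| and |x + y| has a square at most their product; s selects it. *)
Lemma sqrt_dist (x y : C) :
  exists s : bool, normc ((-1) ^+ s * x - y) ^+ 2 <= normc (x ^+ 2 - y ^+ 2).
Proof.
have -> : x ^+ 2 - y ^+ 2 = (x - y) * (x + y) by ring.
rewrite normcM; have [h|/ltW h] := leP (normc (x - y)) (normc (x + y)).
  by exists false; rewrite expr0 mul1r expr2 ler_wpM2l ?normc_ge0.
exists true; rewrite expr1 mulN1r -opprD normc_opp expr2.
by rewrite ler_wpM2r ?normc_ge0.
Qed.

(* The principal square root is discontinuous on its branch cut, so the roots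
   can be followed only up to a swap. *)
Lemma quad_root_dist a b c b' c' (e : R) : a != 0 -> 0 < e ->
  normc (b - b') < e ->
  normc ((b ^+ 2 - 4 * a * c) - (b' ^+ 2 - 4 * a * c')) < e ^+ 2 ->
  exists s : bool,
    normc (quad_root s a b c - quad_root false a b' c') < e / normc a /\
    normc (quad_root (~~ s) a b c - quad_root true a b' c') < e / normc a.
Proof.
move=> a0 e0 hb hD; rewrite /quad_root.
have A0 : 0 < normc a by rewrite normc_gt0.
have := sqrtCK (b ^+ 2 - 4 * a * c); have := sqrtCK (b' ^+ 2 - 4 * a * c').
move: (sqrtC _) (sqrtC _) => x y yE xE; rewrite -yE -xE in hD.
have [s hs] := sqrt_dist x y; exists s.
have hxy : normc ((-1) ^+ s * x - y) < e.
  rewrite -(@ltr_pXn2r _ 2)// ?nnegrE ?normc_ge0 ?(ltW e0)//.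
  exact: le_lt_trans hs hD.
(* Each numerator changes by less than e from b and e from the square root; the 2 in the denominator
   2a compensates. *)
have bound (v : C) : normc v < e + e -> normc (v / (2 * a)) < e / normc a.
  move=> hv; rewrite normcM normcV normcM (normc_nat R 2) invfM mulrA.
  by rewrite ltr_pM2r ?invr_gt0// ltr_pdivrMr// mulr_natr mulr2n.
split.
- have -> : (- b + (-1) ^+ s * x) / (2 * a) - (- b' + (-1) ^+ false * y) / (2 * a) =
    (- (b - b') + ((-1) ^+ s * x - y)) / (2 * a) by field.
  by apply: bound; rewrite (le_lt_trans (ler_normcD _ _))// normc_opp ltrD.
- have -> : (- b + (-1) ^+ (~~ s) * x) / (2 * a) - (- b' + (-1) ^+ true * y) / (2 * a) =
    - ((b - b') + ((-1) ^+ s * x - y)) / (2 * a).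
    by case: (s) => /=; field.
  by apply: bound; rewrite normc_opp (le_lt_trans (ler_normcD _ _))// ltrD.
Qed.

End Quadratic.

(** * Cubics and their deflation *)

Section Cubic.
Variable R : realType.
Local Notation C := R[i].
Variables (a0 a1 a2 a3 : C) (p : {poly C}).
Hypothesis pE : p = a3 *: 'X^3 + a2 *: 'X^2 + a1 *: 'X + a0%:P.

Lemma size_cubic : a3 != 0 -> (1 < size p)%N.
Proof.
move=> h; rewrite ltnNge; apply: contra h => /leq_sizeP /(_ 3%N isT).
by rewrite pE !coefE /= !mulr0 !addr0 mulr1 => ->.
Qed.

Lemma deriv_cubic : p^`() = (3 * a3) *: 'X^2 + (2 * a2) *: 'X + a1%:P.
Proof.
rewrite pE !derivD !derivZ !derivXn derivX derivC -!mul_polyC !polyCM !polyC_natr /=.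
ring.
Qed.

(** Horner division by X - z. The quotient has coefficients polynomial in z, which makes the
    deflated quadratic continuous in z. *)
Lemma cubic_eq_XsubC (z : C) :
  p = (a3 *: 'X^2 + (a3 * z + a2) *: 'X + (a3 * z ^+ 2 + a2 * z + a1)%:P) * ('X - z%:P)
      + p.[z]%:P.
Proof.
rewrite pE !hornerE -!mul_polyC !(polyCD, polyCM, polyC_exp); ring.
Qed.

Lemma divp_cubic_XsubC (z : C) :
  p %/ ('X - z%:P) =
  a3 *: 'X^2 + (a3 * z + a2) *: 'X + (a3 * z ^+ 2 + a2 * z + a1)%:P.
Proof.
rewrite {1}(cubic_eq_XsubC z) divp_addl_mul_small//.
by rewrite size_XsubC (leq_ltn_trans (size_polyC_leq1 _)).
Qed.

Lemma deflated_root_cubic s (z : C) :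
  deflated_root s p z =
  quad_root s a3 (a3 * z + a2) (a3 * z ^+ 2 + a2 * z + a1).
Proof.
rewrite /deflated_root divp_cubic_XsubC !coefE /=.
by congr quad_root; ring.
Qed.

(** The linear coefficient and the discriminant of the deflated quadratic are polynomials B and D in
    z, so [horner_cvg] applies to both. The sign s may vary with z. *)
Lemma deflated_root_cvg (zeta : C) (e : R) : a3 != 0 -> 0 < e ->
  exists2 d : R, 0 < d & forall z, normc (z - zeta) < d -> exists s : bool,
    normc (deflated_root s p z - deflated_root false p zeta) < e /\
    normc (deflated_root (~~ s) p z - deflated_root true p zeta) < e.
Proof.
move=> a30 e0; have A0 : 0 < normc a3 by rewrite normc_gt0.
have E0 : 0 < e * normc a3 by rewrite mulr_gt0.
pose B : {poly C} := a3 *: 'X + a2%:P.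
pose D : {poly C} := B ^+ 2 - (4 * a3) *: (a3 *: 'X^2 + a2 *: 'X + a1%:P).
have BE v : B.[v] = a3 * v + a2 by rewrite !hornerE.
have DE v : D.[v] = (a3 * v + a2) ^+ 2 - 4 * a3 * (a3 * v ^+ 2 + a2 * v + a1).
  by rewrite !hornerE; ring.
have [d1 d10 h1] := horner_cvg B zeta E0.
have [d2 d20 h2] := horner_cvg D zeta (exprn_gt0 2 E0).
exists (Num.min d1 d2) => [|z]; first by rewrite lt_min d10.
rewrite lt_min => /andP[/h1 + /h2]; rewrite !BE !DE => hB hD.
have := quad_root_dist a30 E0 hB hD.
rewrite mulfK ?gt_eqF// !deflated_root_cubic => -[s hs].
by exists s; rewrite !deflated_root_cubic.
Qed.

End Cubic.

(** * Topological convergence and the theorem on cubics *)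

Lemma complex_cvgP (R : realType) (z : nat -> R[i]) (l : R[i]) :
  (forall e : R, 0 < e -> exists T : nat, forall t, (T <= t)%N -> normc (z t - l) < e) ->
  (z : nat -> R[i]^o) @ \oo --> (l : R[i]^o).
Proof.
(* Radii of this topology lie in [R[i]]. A positive one has imaginary part 0, so its real part can
   be passed to the hypothesis. *)
move=> h; apply/cvgrPdist_lt => e; rewrite ltcE => /andP[/eqP e0 /h[T hT]].
exists T => // t /= /hT; rewrite distrC [`|_|]normcE ltcE /= e0 => ->.
by rewrite eqxx.
Qed.

Theorem theorem5 (R : realType) (a0 a1 a2 a3 : R[i]) (p : {poly R[i]}) (c : R[i])
    (ha3 : a3 != 0)
    (hp : p = a3 *: 'X^3 + a2 *: 'X^2 + a1 *: 'X + a0%:P)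
    (hc : root p^`() c)
    (hmin : forall w : R[i], root p^`() w -> normc p.[c] <= normc p.[w]) :
  (forall w : R[i],
      root p^`() w <-> exists s : bool, w = quad_root s (3 * a3) (2 * a2) a1) /\
  (forall z : nat -> R[i], rnm_orbit p c z ->
    exists zeta : R[i],
      [/\ root p zeta,
          ((z : nat -> R[i]^o) @ \oo --> (zeta : R[i]^o)) &
          exists w1 w2 : R[i],
            p = a3 *: (('X - zeta%:P) * ('X - w1%:P) * ('X - w2%:P)) /\
            forall eps : R, 0 < eps ->
              exists T : nat, forall t : nat, (T <= t)%N ->
                normc (z t - zeta) < eps /\
                exists s : bool,
                  normc (deflated_root s p (z t) - w1) < eps /\
                  normc (deflated_root (~~ s) p (z t) - w2) < eps]).
Proof.
split=> [w|z hz].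
  rewrite (deriv_cubic hp); apply: root_quad.
  by rewrite mulf_neq0// pnatr_eq0.
have [zeta pzeta hzeta] := rnm_orbit_cvg (size_cubic hp ha3) hmin hz.
exists zeta; split => //; first exact: complex_cvgP.
(* Deflation at the exact root zeta has remainder p(zeta) = 0, so its quadratic carries the other
   two roots with multiplicity. *)
exists (deflated_root false p zeta), (deflated_root true p zeta); split.
  rewrite {1}(cubic_eq_XsubC hp zeta) (rootP pzeta) addr0 (quad_factor _ _ ha3).
  by rewrite !(deflated_root_cubic hp) -scalerAl; congr (_ *: _); ring.
move=> e e0; have [T1 h1] := hzeta e e0.
have [d d0 hd] := deflated_root_cvg hp zeta ha3 e0; have [T2 h2] := hzeta d d0.
exists (maxn T1 T2) => t; rewrite geq_max => /andP[/h1 ? /h2 /hd ?]; by split.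
Qed.
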